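(* Let $S_0,S_1\subset\mathbb{R}^n$ be compact sets, let $\Sigma_0,\Sigma_1$ be the $\sigma$-fields of Borel sets of $S_0$ and $S_1$ respectively, let $\mu_0$ and $\mu_1$ be absolutely continuous probability measures on $\Sigma_0$ and $\Sigma_1$ respectively, and let $q$ be an everywhere continuous, strictly positive function on $S_0\times S_1$. Then there is a unique pair $\pi,\nu$ of measures on $\Sigma_0\times\Sigma_1$ for which: 1. $\pi$ is a probability measure and $\nu$ is a finite product measure; 2. $\pi(E_0\times S_1)=\mu_0(E_0)$ for all $E_0\in\Sigma_0$ and $\pi(S_0\times E_1)=\mu_1(E_1)$ for all $E_1\in\Sigma_1$; 3. $d\pi/d\nu=q$.
   Context: Absolute continuity of $\mu_0,\mu_1$ is with respect to Lebesgue measure on $\mathbb{R}^n$. $\Sigma_0\times\Sigma_1$ denotes the product $\sigma$-field on $S_0\times S_1$. A finite product measure is a measure of the form $\nu=\nu_0\times\nu_1$ with $\nu_0$ a finite measure on $\Sigma_0$ and $\nu_1$ a finite measure on $\Sigma_1$. The condition $d\pi/d\nu=q$ means that $\pi$ is absolutely continuous with respect to $\nu$ with Radon-Nikodym derivative $q$, i.e. $\pi(E)=\int_E q\,d\nu$ for all $E\in\Sigma_0\times\Sigma_1$. *)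

(* Defs.v *)
From HB Require Import structures.
From mathcomp Require Import all_boot all_order all_algebra.
From mathcomp Require Import all_classical all_reals all_analysis measurable_realfun.

Set Implicit Arguments.
Unset Strict Implicit.
Unset Printing Implicit Defensive.

Import Order.TTheory GRing.Theory Num.Theory.
Import numFieldNormedType.Exports.

Local Open Scope classical_set_scope.
Local Open Scope ring_scope.

Definition borel_rV (R : realType) (n : nat) : Type :=
  g_sigma_algebraType [set U : set 'rV[R]_n | open U].

HB.instance Definition _ (R : realType) (n : nat) :=
  Measurable.copy (borel_rV R n)
    (g_sigma_algebraType [set U : set 'rV[R]_n | open U]).

(* Lebesgue measure on R^n, as the n-fold product of lebesgue_measure transported
   along the isomorphism R * R^n -> R^(1 + n). It is only meant to be evaluated on
   Borel sets; see lebesgue_rV_box. *)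
Fixpoint lebesgue_rV (R : realType) (n : nat) : set (borel_rV R n) -> \bar R :=
  match n return set (borel_rV R n) -> \bar R with
  | 0 => \d_((0 : 'rV[R]_0) : borel_rV R 0)
  | m.+1 => pushforward (lebesgue_measure \x lebesgue_rV (R := R) (n := m))%E
      (fun p : measurableTypeR R * borel_rV R m =>
         (row_mx (p.1 : R)%:M (p.2 : 'rV[R]_m) : 'rV[R]_(1 + m)) : borel_rV R m.+1)
  end.
Arguments lebesgue_rV R n _ : clear implicits.

Lemma lebesgue_rV_set0 (R : realType) (n : nat) : lebesgue_rV R n set0 = 0%E.
Proof.
elim: n => [|n IHn]; first by rewrite /= measure0.
by rewrite /= /pushforward preimage_set0 [LHS]integral0_eq// => x _ /=; rewrite xsection0.
Qed.

Lemma lebesgue_rV_box (R : realType) (n : nat) (a b : 'rV[R]_n) :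
  (forall i, a 0 i <= b 0 i) ->
  lebesgue_rV R n [set x : 'rV[R]_n | forall i, a 0 i <= x 0 i <= b 0 i] =
  (\prod_(i < n) (b 0 i - a 0 i))%:E.
Proof.
elim: n a b => [|n IHn] a b ab.
  rewrite /= diracE big_ord0 mem_set//=; by case.
pose a' : 'rV[R]_n := \row_i a 0 (lift ord0 i).
pose b' : 'rV[R]_n := \row_i b 0 (lift ord0 i).
have ab' i : a' 0 i <= b' 0 i by rewrite !mxE.
pose v := \prod_(i < n) (b 0 (lift ord0 i) - a 0 (lift ord0 i)).
have v0 : 0 <= v by apply: prodr_ge0 => i _; rewrite subr_ge0.
have vE : v = \prod_(i < n) (b' 0 i - a' 0 i).
  by apply: eq_bigr => i _; rewrite !mxE.
rewrite big_ord_recl /= -/v /pushforward /product_measure1.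
rewrite (eq_integral
  (fun x => (\1_(`[a 0 ord0, b 0 ord0]%classic : set (measurableTypeR R)) x)%:E * v%:E)%E).
  rewrite ge0_integralZr//; last first.
    by apply/measurable_EFinP; exact: measurable_indic.
  rewrite integral_indic// setIT.
  rewrite EFinM; congr (_ * _)%E.
  apply: (eq_trans (lebesgue_measure_itv `[a 0 ord0, b 0 ord0])); rewrite /= lte_fin.
  by case: ltgtP (ab ord0) => // -> _; rewrite subrr.
move=> x _ /=; rewrite indicE.
have rowE (y : 'rV[R]_n) i : (row_mx x%:M y : 'rV[R]_(1 + n)) 0 (lift ord0 i) = y 0 i.
  by rewrite -rshift1 row_mxEr.
have row0 (y : 'rV[R]_n) : (row_mx x%:M y : 'rV[R]_(1 + n)) 0 ord0 = x.
  have -> : (ord0 : 'I_n.+1) = lshift n (0 : 'I_1) by exact/val_inj.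
  by rewrite row_mxEl mxE.
have [/set_mem xab|xab] := boolP (x \in _).
  rewrite mul1e vE -IHn//; congr (lebesgue_rV R n _); apply/seteqP; split => y /=.
    by move=> /xsectionP/= yab i; have := yab (lift ord0 i); rewrite rowE !mxE.
  move=> yab; apply/xsectionP => /= i.
  have [j|] := unliftP ord0 i => ->; first by rewrite rowE; have := yab j; rewrite !mxE.
  by rewrite row0; move: xab; rewrite /= in_itv.
rewrite mul0e -[RHS](lebesgue_rV_set0 R n); congr (lebesgue_rV R n _).
rewrite -subset0 => y /xsectionP/= /(_ ord0); rewrite row0 => xab'.
by case/negP: xab; rewrite inE/= in_itv.
Qed.

(* The subspace S of R^n with its Borel sigma-field. The library's measurable types
   are pointed, hence the proof of S !=set0 carried by the type; neither the
   topology nor the sigma-field depends on it. *)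
Definition borel_sub (R : realType) (n : nat) (S : set 'rV[R]_n)
  (h : S !=set0) : Type := set_type S.

Section borel_sub.
Variables (R : realType) (n : nat) (S : set 'rV[R]_n) (h : S !=set0).

Definition borel_sub_point : borel_sub h :=
  let: exist x Sx := cid h in exist _ x (mem_set Sx).

HB.instance Definition _ := Choice.copy (borel_sub h) (set_type S).
HB.instance Definition _ := isPointed.Build (borel_sub h) borel_sub_point.
HB.instance Definition _ := Measurable.copy (borel_sub h)
  (@g_sigma_algebraType (borel_sub h) [set U : set (set_type S) | open U]).

(* mu is carried to R^n by the inclusion: Lebesgue-null A give mu (S `&` A) = 0. *)
Definition abs_continuous (mu : set (borel_sub h) -> \bar R) :=
  pushforward mu (set_val : borel_sub h -> borel_rV R n) `<< lebesgue_rV R n.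

End borel_sub.

Section schrodinger_pair.
Local Open Scope ereal_scope.
Context d0 d1 (T0 : measurableType d0) (T1 : measurableType d1) (R : realType).

Definition finite_product_measure (nu : set (T0 * T1) -> \bar R) :=
  exists (nu0 : {finite_measure set T0 -> \bar R})
         (nu1 : {finite_measure set T1 -> \bar R}),
    forall E, measurable E -> nu E = (nu0 \x nu1) E.

(* d pi / d nu = q. The library's Radon_Nikodym is not used because it selects
   one representative, determined only up to nu-null sets. *)
Definition has_density (pi nu : set (T0 * T1) -> \bar R) (q : T0 * T1 -> R) :=
  forall E, measurable E -> pi E = \int[nu]_(z in E) (q z)%:E.

Definition schrodinger_pair (mu0 : set T0 -> \bar R) (mu1 : set T1 -> \bar R)
    (q : T0 * T1 -> R) (pi nu : set (T0 * T1) -> \bar R) :=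
  [/\ pi setT = 1, finite_product_measure nu,
      forall E0, measurable E0 -> pi (E0 `*` setT) = mu0 E0,
      forall E1, measurable E1 -> pi (setT `*` E1) = mu1 E1
    & has_density pi nu q].

End schrodinger_pair.

(* Main.v *)
Require Import Defs.
From HB Require Import structures.
From mathcomp Require Import all_boot all_order all_algebra.
From mathcomp Require Import all_classical all_reals all_analysis.
From mathcomp Require Import unstable measurable_realfun ring lra.

Set Implicit Arguments.
Unset Strict Implicit.
Unset Printing Implicit Defensive.

Import Order.TTheory GRing.Theory Num.Theory.
Import numFieldNormedType.Exports.

Local Open Scope classical_set_scope.
Local Open Scope ring_scope.

(* If nu = nu0 x nu1 and u(x) = \int q(x, y) nu1(dy), p(y) = \int q(x, y) nu0(dx),
   the marginal conditions say nu0 = mu0 / u and nu1 = mu1 / p. Hence a solution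
   is the same thing as a fixed point u = T u of
     (T u)(x) = \int q(x, y) / p(y) mu1(dy),  p(y) = \int q(x, y) / u(x) mu0(dx),
   taken up to a scalar, since replacing u by c u divides nu0 by c and multiplies
   nu1 by c. As 0 < m <= q <= M, T strictly contracts the oscillation ratio
   (sup v / u) / (inf v / u) (an elementary form of Birkhoff's theorem on
   Hilbert's projective metric), which gives uniqueness of u up to a scalar.
   Moreover \int (T u / u) dmu0 = 1 for every u, so no normalization is needed:
   the iterates u_n = T^n 1 satisfy u_n / t_n <= u_(n+1) <= t_n u_n with
   t_n - 1 decaying geometrically, and converge to a fixed point. *)

(** * Functions bounded away from zero and infinity, and Hilbert's metric *)

Section tame.
Context d (T : measurableType d) (R : realType).
Implicit Types u v : T -> R.

(** The uniform bounds make the class stable under reciprocals and integrable for every finite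
    measure, so that [u] and its reciprocal can both be integrated freely below. *)
Definition tame u := measurable_fun setT u /\
  exists c C, 0 < c /\ forall x, c <= u x <= C.

Lemma tame_gt0 u x : tame u -> 0 < u x.
Proof. by case=> _ [c [C [c0 /(_ x)/andP[+ _]]]]; exact: lt_le_trans. Qed.

Lemma tame_cst (c : R) : 0 < c -> tame (cst c).
Proof. by move=> c0; split => //; exists c, c; split => // x; rewrite lexx. Qed.

Lemma tameV u : tame u -> tame (fun x => (u x)^-1).
Proof.
move=> tu; have [mu [c [C [c0 uB]]]] := tu; split.
  (* For positive [u] the reciprocal is the real power of exponent -1, a measurable function. *)
  apply: (eq_measurable_fun (fun x => u x `^ (-1))).
    by move=> x _; rewrite powR_inv1// ltW// tame_gt0.
  exact: measurableT_comp (measurable_powR _) mu.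
exists C^-1, c^-1; have /andP[cu uC] := uB point.
have C0 : 0 < C by rewrite (lt_le_trans c0)// (le_trans cu).
split; first by rewrite invr_gt0.
move=> x; have /andP[{}cu {}uC] := uB x.
by rewrite !lef_pV2 ?posrE ?(tame_gt0 _ tu)// uC.
Qed.

Lemma tameZ c u : 0 < c -> tame u -> tame (fun x => c * u x).
Proof.
move=> c0 [mu [e [E [e0 uB]]]]; split; first exact: measurable_funM.
by exists (c * e), (c * E); split=> [|y]; rewrite ?mulr_gt0// !ler_pM2l.
Qed.

Lemma tameD u v : tame u -> tame v -> tame (fun x => u x + v x).
Proof.
move=> [mu [c [C [c0 uB]]]] [mv [e [E [e0 vB]]]]; split.
  exact: measurable_funD.
exists (c + e), (C + E); split; first exact: addr_gt0.
by move=> x; have /andP[? ?] := uB x; have /andP[? ?] := vB x; rewrite !lerD.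
Qed.

Lemma integrable_bounded (mu : {finite_measure set T -> \bar R}) u (C : R) :
  measurable_fun setT u -> (forall x, `|u x| <= C) ->
  mu.-integrable setT (EFin \o u).
Proof.
move=> mu_ uC; apply: measurable_bounded_integrable => //.
  by rewrite ltey_eq fin_num_measure.
exists C; split; first exact: num_real.
by move=> y Cy x _ /=; rewrite (le_trans (uC x))// ltW.
Qed.

Lemma integrable_tame (mu : {finite_measure set T -> \bar R}) u :
  tame u -> mu.-integrable setT (EFin \o u).
Proof.
move=> tu; have [mu_ [c [C [c0 uB]]]] := tu.
apply: (@integrable_bounded _ _ C) => // x.
by have /andP[_ uC] := uB x; rewrite gtr0_norm// tame_gt0.
Qed.

(* [ratio_within t u v] bounds the oscillation of [v / u]: its supremum is at
   most [t] times its infimum, i.e. [u] and [v] are at distance at most [ln t]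
   in Hilbert's projective metric. *)
Definition ratio_within t u v :=
  exists2 a : R, 0 < a & forall x, a * u x <= v x <= a * t * u x.

(** The ratio of the reciprocals is [u / v], with values between [(a * t)^-1] and [a^-1], whose
    quotient is again [t]: inversion preserves Hilbert's metric. *)
Lemma ratio_withinV t u v : (forall x, 0 < u x) -> 0 < t ->
  ratio_within t u v ->
  ratio_within t (fun x => (u x)^-1) (fun x => (v x)^-1).
Proof.
move=> u0 t0 [a a0 auv]; exists (a * t)^-1 => [|x].
  by rewrite invr_gt0 mulr_gt0.
have /andP[h1 h2] := auv x.
have v0 : 0 < v x by rewrite (lt_le_trans _ h1)// mulr_gt0.
rewrite -invfM lef_pV2 ?posrE ?mulr_gt0// h2/=.
rewrite invfM mulrVK ?unitfE ?gt_eqF// -invfM lef_pV2 ?posrE ?mulr_gt0//.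
Qed.

End tame.

(** * Contraction by a kernel bounded between two positive constants *)

Section kernel_operator.
Context d d' (X : measurableType d) (Y : measurableType d') (R : realType).
Variables (k : X * Y -> R) (m M : R).
Hypotheses (mk : measurable_fun setT k) (m0 : 0 < m).
Hypothesis kB : forall z, m <= k z <= M.
Variable mu : {finite_measure set Y -> \bar R}.
Implicit Types u v : Y -> R.

Definition kint u x := \int[mu]_y (k (x, y) * u y).

Let k0 z : 0 < k z.
Proof. by have /andP[+ _] := kB z; exact: lt_le_trans. Qed.

Let M0 : 0 < M.
Proof. by have /andP[+ +] := kB point; move=> /(lt_le_trans m0); exact: lt_le_trans. Qed.

Lemma measurable_ker x : measurable_fun setT (fun y => k (x, y)).
Proof. exact: measurableT_comp mk (pair1_measurable x). Qed.

Lemma tame_ker u x : tame u -> tame (fun y => k (x, y) * u y).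
Proof.
move=> [mu_ [c [C [c0 uB]]]]; split.
  by apply: measurable_funM => //; exact: measurable_ker.
exists (m * c), (M * C); split; first by rewrite mulr_gt0.
move=> y; have /andP[? ?] := kB (x, y); have /andP[? ?] := uB y.
by rewrite !ler_pM// ltW// (lt_le_trans c0).
Qed.

(** A real-valued integral is cut to 0 by [fine] when infinite; tameness excludes this, so that
    Tonelli can be applied to the extended-real form. *)
Lemma EFin_kint u x : tame u ->
  (kint u x)%:E = (\int[mu]_y (k (x, y) * u y)%:E)%E.
Proof.
move=> tu; rewrite fineK//; apply: integrable_fin_num => //.
exact: integrable_tame (tame_ker x tu).
Qed.

Lemma le_kint u v x : tame u -> tame v -> (forall y, u y <= v y) ->
  kint u x <= kint v x.
Proof.
move=> tu tv uv; apply: le_Rintegral => //; try exact/integrable_tame/tame_ker.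
by move=> y _; rewrite ler_wpM2l// ltW.
Qed.

Lemma kintZ a u x : tame u -> kint (fun y => a * u y) x = a * kint u x.
Proof.
move=> tu; rewrite -RintegralZl//; last exact: integrable_tame (tame_ker x tu).
by apply: eq_Rintegral => y _; ring.
Qed.

Let kint_le_int u x : tame u -> kint u x <= M * (\int[mu]_y u y).
Proof.
move=> tu; have iu := integrable_tame mu tu.
rewrite -RintegralZl//; apply: le_Rintegral => //.
- exact: integrable_tame (tame_ker x tu).
- exact: integrable_tame (tameZ M0 tu).
- by move=> y _; rewrite ler_wpM2r ?(ltW (tame_gt0 _ tu))//; have /andP[] := kB (x, y).
Qed.

(** Integrate [(k - m) * (v - u) >= 0]. Terms are moved across the inequality so that only tame
    functions are integrated, since [v - u] may vanish. *)
Let int_le_kint u v x : tame u -> tame v -> (forall y, u y <= v y) ->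
  m * (\int[mu]_y v y - \int[mu]_y u y) <= kint v x - kint u x.
Proof.
move=> tu tv uv; rewrite mulrBr lerBlDr addrAC lerBrDr.
have imu := integrable_tame mu (tameZ m0 tu).
have imv := integrable_tame mu (tameZ m0 tv).
have iku := integrable_tame mu (tame_ker x tu).
have ikv := integrable_tame mu (tame_ker x tv).
rewrite -!RintegralZl//; try exact: integrable_tame.
rewrite /kint -!RintegralD//; apply: le_Rintegral => //.
- exact: integrable_tame (tameD (tameZ m0 tv) (tame_ker x tu)).
- exact: integrable_tame (tameD (tame_ker x tv) (tameZ m0 tu)).
- move=> y _; have /andP[mky _] := kB (x, y); have := uv y; nra.
Qed.

Hypothesis mu_gt0 : (0 < mu setT)%E.

Let int_gt0 u : tame u -> 0 < \int[mu]_y u y.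
Proof.
move=> tu; have [mu_ [c [C [c0 uB]]]] := tu.
apply: (@lt_le_trans _ _ (\int[mu]_(y in setT) c)).
  rewrite Rintegral_cst// mulr_gt0// fine_gt0// mu_gt0.
  by rewrite ltey_eq fin_num_measure.
apply: le_Rintegral => //; try exact: integrable_tame.
  exact: integrable_tame (tame_cst _ c0).
by move=> y _; have /andP[] := uB y.
Qed.

(* Writing [D] for the excess of [\int v - a \int u] over [\int u], the part of
   [k] above its minimum [m] pushes the lower bound [a] up by [m / M * D] and
   the upper bound [a t] down by [m / M * (a t - a - D)]. *)
Lemma ratio_within_kint t u v : tame u -> tame v -> 1 <= t ->
  ratio_within t u v ->
  ratio_within (1 + (1 - m / M) * (t - 1)) (kint u) (kint v).
Proof.
move=> tu tv t1 [a a0 auv].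
have t0 : 0 < t by rewrite (lt_le_trans ltr01).
set I := \int[mu]_y u y; set A := \int[mu]_y v y.
have I0 : 0 < I by exact: int_gt0.
have tau := tameZ a0 tu.
have tatu := tameZ (mulr_gt0 a0 t0) tu.
have iZ b : \int[mu]_y (b * u y) = b * I.
  by rewrite RintegralZl//; exact: integrable_tame.
pose D := A / I - a.
have AE : A = (a + D) * I by rewrite /D addrC subrK divfK// gt_eqF.
pose e := m / M.
have e0 : 0 < e by rewrite divr_gt0.
have mE : m = e * M by rewrite /e divfK// gt_eqF.
have e1 : e <= 1.
  by rewrite ler_pdivrMr// mul1r; have /andP[+ +] := kB point; exact: le_trans.
have D0 : 0 <= D.
  suff : 0 <= D * I by rewrite pmulr_lge0.
  have -> : D * I = A - a * I by rewrite AE; ring.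
  rewrite subr_ge0 -iZ; apply: le_Rintegral => //; try exact: integrable_tame.
  by move=> y _; have /andP[] := auv y.
have Dt : D <= a * t - a.
  suff : 0 <= (a * t - a - D) * I by rewrite pmulr_lge0// subr_ge0.
  have -> : (a * t - a - D) * I = a * t * I - A by rewrite AE; ring.
  rewrite subr_ge0 -iZ; apply: le_Rintegral => //; try exact: integrable_tame.
  by move=> y _; have /andP[] := auv y.
exists (a + e * D) => [|x]; first by rewrite ltr_pwDl// mulr_ge0// ltW.
have kuM := kint_le_int x tu.
have := @int_le_kint _ _ x tau tv (fun y => proj1 (andP (auv y))).
have := @int_le_kint _ _ x tv tatu (fun y => proj2 (andP (auv y))).
rewrite !iZ !kintZ// -/I -/A in kuM * => hi lo.
set U := kint u x in kuM hi lo *; set V := kint v x in hi lo *.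
have U0 : 0 <= U.
  by apply: Rintegral_ge0 => y _; rewrite mulr_ge0 ?ltW// tame_gt0.
have lo' : e * D * U <= V - a * U.
  apply: le_trans lo; rewrite AE mE.
  have -> : e * M * ((a + D) * I - a * I) = e * D * (M * I) by ring.
  by rewrite ler_wpM2l// mulr_ge0// ltW.
have hi' : e * (a * t - a - D) * U <= a * t * U - V.
  apply: le_trans hi; rewrite AE mE.
  have -> : e * M * (a * t * I - (a + D) * I) = e * (a * t - a - D) * (M * I) by ring.
  by rewrite ler_wpM2l// mulr_ge0 ?subr_ge0// ltW.
apply/andP; split; first by rewrite mulrDl; lra.
rewrite -/e; apply: (@le_trans _ _ ((a * t - e * (a * t - a - D)) * U)); first by lra.
rewrite ler_wpM2r//.
(* The improved upper bound equals [a + e * D + a * (1 - e) * (t - 1)]; the claimed one exceeds it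
   by exactly this nonnegative product. *)
rewrite -subr_ge0 [leRHS](_ : _ = e * D * ((1 - e) * (t - 1))); last by ring.
by apply: mulr_ge0; [exact: mulr_ge0 (ltW e0) D0|rewrite mulr_ge0// subr_ge0].
Qed.

Lemma tame_kint u : tame u -> tame (kint u).
Proof.
move=> tu; split.
  (* Measurability in [x] comes from Tonelli, as [kint u] is the inner integral of a jointly
     measurable nonnegative function. *)
  have mF : measurable_fun setT (fun z : X * Y => (k z * u z.2)%:E).
    apply/measurable_EFinP/measurable_funM => //.
    by apply: measurableT_comp => //; case: tu.
  have F0 z : (0 <= (k z * u z.2)%:E)%E.
    by rewrite lee_fin mulr_ge0 ?ltW// tame_gt0.
  have := measurable_fun_fubini_tonelli_F (m2 := mu) _ mF F0.
  rewrite (_ : fubini_F _ _ = EFin \o kint u) => [/measurable_EFinP//|].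
  by apply/funext => x /=; rewrite EFin_kint.
exists (m * \int[mu]_y u y), (M * \int[mu]_y u y).
split; first by rewrite mulr_gt0// int_gt0.
move=> x; rewrite kint_le_int// andbT.
rewrite -RintegralZl//; last exact: integrable_tame.
apply: le_Rintegral => //.
- exact: integrable_tame (tameZ m0 tu).
- exact: integrable_tame (tame_ker x tu).
- by move=> y _; rewrite ler_wpM2r ?(ltW (tame_gt0 _ tu))//; have /andP[] := kB (x, y).
Qed.

End kernel_operator.

(** * One half-step of the iteration *)

Section scaling.
Context d d' (X : measurableType d) (Y : measurableType d') (R : realType).
Variables (k : X * Y -> R) (m M : R).
Hypotheses (mk : measurable_fun setT k) (m0 : 0 < m).
Hypothesis kB : forall z, m <= k z <= M.
Variable mu : {finite_measure set Y -> \bar R}.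
Hypothesis mu_gt0 : (0 < mu setT)%E.
Implicit Types u v : Y -> R.

(** Half an iteration of Sinkhorn's scaling: once one factor is [mu / u], this is the function by
    which the other prescribed marginal must be divided to give the other factor. *)
Definition scaling u := kint k mu (fun y => (u y)^-1).

Lemma tame_scaling u : tame u -> tame (scaling u).
Proof. by move=> tu; apply: (tame_kint mk m0 kB) => //; exact: tameV. Qed.

Lemma ratio_within_scaling t u v : tame u -> tame v -> 1 <= t ->
  ratio_within t u v ->
  ratio_within (1 + (1 - m / M) * (t - 1)) (scaling u) (scaling v).
Proof.
move=> tu tv t1 uv; apply: (ratio_within_kint mk m0 kB) => //; try exact: tameV.
apply: ratio_withinV => // [y|]; first exact: tame_gt0.
exact: lt_le_trans t1.
Qed.

Lemma le_scaling c u v x : 0 < c -> tame u -> tame v ->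
  (forall y, u y <= c * v y) -> scaling v x <= c * scaling u x.
Proof.
move=> c0 tu tv uv; have tVu := tameV tu; have tVv := tameV tv.
rewrite /scaling -(kintZ mk m0 kB)//; apply: (le_kint mk m0 kB) => //.
  exact: tameZ.
move=> y; have u0 := tame_gt0 y tu; have v0 := tame_gt0 y tv.
by rewrite -ler_pdivrMl// -invfM lef_pV2 ?posrE ?mulr_gt0.
Qed.

Lemma scalingZ c u : 0 < c -> tame u ->
  scaling (fun y => c * u y) = (fun x => c^-1 * scaling u x).
Proof.
move=> c0 tu; apply/funext => x.
rewrite /scaling -(kintZ mk m0 kB); last exact: tameV.
by congr (kint _ _ _ _); apply/funext => y; rewrite invfM.
Qed.

End scaling.

(** * The fixed-point map and its contraction rate *)

Section schrodinger_map.
Context d0 d1 (X : measurableType d0) (Y : measurableType d1) (R : realType).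
Variables (q : X * Y -> R) (m M : R).
Hypotheses (mq : measurable_fun setT q) (m0 : 0 < m).
Hypothesis qB : forall z, m <= q z <= M.
Variables (mu0 : probability X R) (mu1 : probability Y R).
Implicit Types u v : X -> R.

Let q' : Y * X -> R := q \o swap.

Let mq' : measurable_fun setT q'.
Proof. by apply: (measurableT_comp mq); exact: measurable_swap. Qed.

Let q'B z : m <= q' z <= M. Proof. exact: qB. Qed.

Definition schrodinger_map u : X -> R :=
  scaling q mu1 (scaling (q \o swap) mu0 u).

Local Notation T := schrodinger_map.

Let mu0_gt0 : (0 < mu0 setT)%E. Proof. by rewrite probability_setT. Qed.
Let mu1_gt0 : (0 < mu1 setT)%E. Proof. by rewrite probability_setT. Qed.

Let tame_s0 u : tame u -> tame (scaling q' mu0 u).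
Proof. exact: (tame_scaling mq' m0 q'B). Qed.

Lemma tame_schrodinger_map u : tame u -> tame (T u).
Proof. by move=> tu; apply: (tame_scaling mq m0 qB) => //; exact: tame_s0. Qed.

(** Each of the two half-steps multiplies the excess of the ratio over 1 by [1 - m / M]. *)
Let r : R := (1 - m / M) ^+ 2.

Let mM : m <= M.
Proof. by have /andP[+ +] := qB point; exact: le_trans. Qed.

Let M0 : 0 < M. Proof. exact: lt_le_trans mM. Qed.

Let e0 : 0 <= 1 - m / M. Proof. by rewrite subr_ge0 ler_pdivrMr// mul1r. Qed.

Let r0 : 0 <= r. Proof. exact: exprn_ge0. Qed.

Let r1 : r < 1.
Proof. by rewrite exprn_ilt1// gtrBl divr_gt0. Qed.

Lemma ratio_within_schrodinger_map t u v : tame u -> tame v -> 0 <= t ->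
  ratio_within (1 + t) u v -> ratio_within (1 + r * t) (T u) (T v).
Proof.
move=> tu tv t0 uv.
have := ratio_within_scaling mq' m0 q'B mu0_gt0 tu tv _ uv.
rewrite lerDl => /(_ t0) => uv'.
have := ratio_within_scaling mq m0 qB mu1_gt0 (tame_s0 tu) (tame_s0 tv) _ uv'.
rewrite !(addrAC 1 _ (-1)) subrr add0r add0r lerDl mulr_ge0// mulrA => /(_ isT).
by rewrite -expr2.
Qed.

(** Each half-step reverses the order and is homogeneous of degree -1; two of them compose to a
    monotone map of degree 1, and this inequality packs both properties. *)
Lemma le_schrodinger_map c u v x : 0 < c -> tame u -> tame v ->
  (forall y, u y <= c * v y) -> T u x <= c * T v x.
Proof.
move=> c0 tu tv uv; apply: (le_scaling mq m0 qB) => //; try exact: tame_s0.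
by move=> y; exact: (le_scaling mq' m0 q'B).
Qed.

(** By Tonelli, integrate first in [x]: the integral of [q (x, y) / u x] against [mu0] is [p y],
    which cancels the factor [(p y)^-1] and leaves the total mass of [mu1]. *)
Lemma integral_schrodinger_map u : tame u ->
  (\int[mu0]_x (T u x / u x)%:E = 1)%E.
Proof.
move=> tu; set p := scaling q' mu0 u; have tp : tame p := tame_s0 tu.
have tVp := tameV tp; have tVu := tameV tu.
have Vp0 y : 0 < (p y)^-1 by exact: (tame_gt0 y tVp).
have Vu0 x : 0 < (u x)^-1 by exact: (tame_gt0 x tVu).
have q0 z : 0 < q z by have /andP[+ _] := qB z; exact: lt_le_trans.
pose f (z : X * Y) : \bar R := (q z * (p z.2)^-1 * (u z.1)^-1)%:E.
have mf : measurable_fun setT f.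
  apply/measurable_EFinP/measurable_funM; [apply: measurable_funM => //|].
    by apply: (measurableT_comp (proj1 tVp)); exact: measurable_snd.
  by apply: (measurableT_comp (proj1 tVu)); exact: measurable_fst.
have f0 z : (0 <= f z)%E by rewrite lee_fin !mulr_ge0// ltW.
transitivity (\int[mu0]_x \int[mu1]_y f (x, y))%E.
  apply: eq_integral => x _; rewrite mulrC EFinM (EFin_kint mq m0 qB)//.
  rewrite -ge0_integralZl//.
  - by apply: eq_integral => y _; rewrite -EFinM mulrC.
  - by apply/measurable_EFinP; have [] := tame_ker mq m0 qB x tVp.
  - by move=> y _; rewrite lee_fin mulr_ge0// ltW.
  - by rewrite lee_fin ltW.
rewrite fubini_tonelli//.
transitivity (\int[mu1]_(y in setT) 1)%E.
  apply: eq_integral => y _.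
  transitivity ((p y)^-1%:E * \int[mu0]_x (q' (y, x) * (u x)^-1)%:E)%E.
    rewrite -ge0_integralZl//.
    - by apply: eq_integral => x _; rewrite -EFinM /f/= mulrA [_^-1 * _]mulrC.
    - by apply/measurable_EFinP; have [] := tame_ker mq' m0 q'B y tVu.
    - by move=> x _; rewrite lee_fin mulr_ge0// ltW//; exact: q0.
    - by rewrite lee_fin ltW.
  rewrite -(EFin_kint mq' m0 q'B)// -EFinM mulVf// gt_eqF// tame_gt0//.
by rewrite integral_cst// mul1e; exact: probability_setT.
Qed.

(* The mean of [T u / u] being 1, its oscillation bounds its distance to 1. *)
Lemma schrodinger_map_near t u : tame u -> 0 < t -> ratio_within t u (T u) ->
  forall x, u x <= t * T u x /\ T u x <= t * u x.
Proof.
move=> tu t0 [a a0 auT].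
have tTu := tame_schrodinger_map tu; have tVu := tameV tu.
have u0 x : 0 < u x by exact: tame_gt0.
have T0 x : 0 < T u x by exact: tame_gt0.
have mTu : measurable_fun setT (fun x => (T u x / u x)%:E).
  by apply/measurable_EFinP/measurable_funM; [case: tTu|case: tVu].
have int1 c : (\int[mu0]_(x in setT) c%:E = c%:E)%E.
  by rewrite integral_cst// [X in (_ * X)%E]probability_setT mule1.
have a1 : a <= 1.
  rewrite -lee_fin -(integral_schrodinger_map tu) -[leLHS]int1.
  apply: ge0_le_integral => //.
  - by move=> x _; rewrite lee_fin ltW.
  - by move=> x _; rewrite lee_fin ler_pdivlMr//; have /andP[] := auT x.
have at1 : 1 <= a * t.
  rewrite -lee_fin -(integral_schrodinger_map tu) -[leRHS]int1.
  apply: ge0_le_integral => //.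
  - by move=> x _; rewrite lee_fin divr_ge0// ltW.
  - by move=> x _; rewrite lee_fin ler_pdivrMr//; have /andP[] := auT x.
move=> x; have /andP[lo hi] := auT x; split.
  apply: (@le_trans _ _ (t * (a * u x))); last by rewrite ler_pM2l.
  by rewrite mulrA ler_peMl ?(ltW (u0 x))// mulrC.
by rewrite (le_trans hi)// -mulrA ler_piMl// mulr_ge0// ltW.
Qed.

End schrodinger_map.

(** * Existence of the fixed point and its uniqueness up to a scalar *)

Lemma prod1D_geometric_le (R : realType) (r c : R) n : 0 <= r < 1 -> 0 <= c ->
  \prod_(j < n) (1 + r ^+ j * c) <= expR (c / (1 - r)).
Proof.
move=> /andP[r0 r1] c0.
(* Since [1 + x <= expR x], the product is at most the exponential of a geometric sum, itself at
   most [c / (1 - r)]. *)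
apply: (@le_trans _ _ (expR (\sum_(j < n) r ^+ j * c))).
  rewrite expR_sum; apply: ler_prod => j _.
  by rewrite expR_ge1Dx addr_ge0// mulr_ge0// exprn_ge0.
rewrite ler_expR -mulr_suml mulrC ler_wpM2l//.
rewrite -(ler_pM2l (x := 1 - r)) ?subr_gt0// divff ?subr_eq0 1?eq_sym ?lt_eqF//.
by rewrite -opprB mulNr -subrX1 opprB lerBlDr lerDl exprn_ge0.
Qed.

Section schrodinger_fixpoint.
Context d0 d1 (X : measurableType d0) (Y : measurableType d1) (R : realType).
Variables (q : X * Y -> R) (m M : R).
Hypotheses (mq : measurable_fun setT q) (m0 : 0 < m).
Hypothesis qB : forall z, m <= q z <= M.
Variables (mu0 : probability X R) (mu1 : probability Y R).

Local Notation T := (schrodinger_map q mu0 mu1).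
Let r : R := (1 - m / M) ^+ 2.

Let r01 : 0 <= r < 1.
Proof.
have mM : m <= M by have /andP[+ +] := qB point; exact: le_trans.
have M0 : 0 < M by exact: lt_le_trans mM.
have e0 : 0 <= 1 - m / M by rewrite subr_ge0 ler_pdivrMr// mul1r.
by rewrite exprn_ge0// exprn_ilt1// gtrBl divr_gt0.
Qed.

(** With [P n] the product of the [t j] for [j < n], [u n x * P n] increases and [u n x / P n]
    decreases in [n]. As [P] has a finite limit [L], [u n] converges pointwise to some [v] with
    [v * P n / L <= u n <= v * L / P n]. Applying the monotone [T] to this sandwich and letting [n]
    grow gives [T v = v]: monotonicity takes the place of continuity of [T]. *)
Lemma schrodinger_map_fixpoint : exists2 u, tame u & T u = u.
Proof.
have /andP[r0 r1] := r01.
pose u n := iter n T (cst 1).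
have tu n : tame (u n).
  elim: n => [|n IHn]; first exact: tame_cst.
  exact: (tame_schrodinger_map mq m0 qB).
have [c c0 u01] : exists2 c : R, 0 <= c & ratio_within (1 + c) (u 0%N) (u 1%N).
  have [_ [a [C [a0 uB]]]] := tu 1%N.
  have aC : a <= C by have /andP[+ +] := uB point; exact: le_trans.
  (* As [u 0] is the constant 1, the bounds [a] and [C] of [u 1] are already bounds of the ratio. *)
  exists (C / a - 1); first by rewrite subr_ge0 ler_pdivlMr// mul1r.
  exists a => // x; rewrite addrC subrK !mulr1 mulrC divfK ?gt_eqF//.
pose t n : R := 1 + r ^+ n * c.
have t1 n : 1 <= t n by rewrite lerDl mulr_ge0// exprn_ge0.
have t0 n : 0 < t n by exact: lt_le_trans (t1 n).
have ut n : ratio_within (t n) (u n) (u n.+1).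
  elim: n => [|n IHn]; first by rewrite /t expr0 mul1r.
  rewrite /t exprS -mulrA.
  apply: (ratio_within_schrodinger_map mq m0 qB mu0 mu1 _ _ _ IHn); [exact: tu|exact: tu n.+1|].
  by rewrite mulr_ge0// exprn_ge0.
have near1 n x : u n x <= t n * u n.+1 x /\ u n.+1 x <= t n * u n x.
  exact: (schrodinger_map_near mq m0 qB).
pose P n : R := \prod_(j < n) t j.
have PS n : P n.+1 = P n * t n by rewrite /P big_ord_recr.
have P0 n : 0 < P n by apply: prodr_gt0.
have uP_nd x : nondecreasing_seq (fun n => u n x * P n).
  apply/nondecreasing_seqP => n; rewrite PS [P n * _]mulrC mulrA.
  apply: ler_wpM2r; first exact: ltW.
  by rewrite mulrC; have [] := near1 n x.
have uVP_ni x : nonincreasing_seq (fun n => u n x / P n).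
  apply/nonincreasing_seqP => n; rewrite PS invfM mulrA -[_ / t n]mulrC mulrA.
  apply: ler_wpM2r; first by rewrite invr_ge0 ltW.
  by rewrite ler_pdivrMl//; have [] := near1 n x.
have P_nd : nondecreasing_seq P.
  by apply/nondecreasing_seqP => n; rewrite PS ler_peMr// ltW.
have cvgP : cvgn P.
  apply: nondecreasing_is_cvgn => //; exists (expR (c / (1 - r))) => _ [n _ <-].
  exact: prod1D_geometric_le r01 c0.
pose L : R := limn P.
have PL n : P n <= L by exact: nondecreasing_cvgn_le.
have L0 : 0 < L by exact: lt_le_trans (PL 0%N).
have u0 n x : 0 < u n x by exact: tame_gt0.
have uP_cvg x : cvgn (fun n => u n x * P n).
  (* The decreasing sequence [u n x / P n] starts at 1, hence [u n x <= P n <= L]. *)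
  apply: nondecreasing_is_cvgn => //; exists (L * L) => _ [n _ <-].
  apply: ler_pM => //; [exact: ltW|exact: ltW|].
  have := uVP_ni x _ _ (leq0n n); rewrite {2}/P big_ord0 /= divr1 ler_pdivrMr// mul1r.
  by move=> /le_trans; apply.
pose v x : R := limn (fun n => u n x * P n) / L.
have uv x : u n x @[n --> \oo] --> v x.
  rewrite [X in X @ _](_ : _ = fun n => u n x * P n / P n); last first.
    by apply/funext => n; rewrite mulfK// gt_eqF.
  by apply: cvgM => //; apply: cvgV; rewrite ?gt_eqF.
have uPvL n x : u n x * P n <= v x * L.
  by rewrite divfK ?gt_eqF//; exact: nondecreasing_cvgn_le.
have vLuP n x : v x / L <= u n x / P n.
  have cu : (u k x / P k) @[k --> \oo] --> v x / L.
    by apply: cvgM => //; apply: cvgV; rewrite ?gt_eqF.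
  by rewrite -(cvg_lim _ cu)//; apply: nonincreasing_cvgn_ge => //; apply/cvg_ex; eexists; exact: cu.
have tv : tame v.
  split.
    by apply: (measurable_fun_cvg (h := u)) => // n; case: (tu n).
  (* These bounds are the sandwich at index 0, where [u] and [P] are both 1. *)
  exists L^-1, L; split; first by rewrite invr_gt0.
  move=> x; have := uPvL 0%N x; have := vLuP 0%N x.
  rewrite /P big_ord0 /u/= divr1 mulr1 => vL Lv; apply/andP; split.
    by rewrite -[leLHS]mul1r ler_pdivrMr.
  by rewrite ler_pdivrMr// mul1r in vL.
exists v => //; apply/funext => x.
have LP_cvg : L / P n @[n --> \oo] --> L / L.
  by apply: cvgM; [exact: cvg_cst|apply: cvgV; rewrite ?gt_eqF].
apply/eqP; rewrite eq_le; apply/andP; split.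
- have cR : (L / P n * u n.+1 x) @[n --> \oo] --> v x.
    rewrite -[v x]mul1r -(@divff _ L) ?gt_eqF//; apply: cvgM => //.
    by rewrite (cvg_shiftS (fun n => u n x)).
  rewrite -(cvg_lim _ cR)//; apply: limr_ge; first by apply/cvg_ex; eexists; exact: cR.
  apply: nearW => n; apply: (le_schrodinger_map mq m0 qB) => //.
    by rewrite divr_gt0.
  by move=> y; rewrite mulrAC -mulrA mulrC -ler_pdivrMr.
- have cR : (P n / L * u n.+1 x) @[n --> \oo] --> v x.
    rewrite -[v x]mul1r -(@divff _ L) ?gt_eqF//; apply: cvgM => //.
      by apply: cvgM => //; exact: cvg_cst.
    by rewrite (cvg_shiftS (fun n => u n x)).
  rewrite -(cvg_lim _ cR)//; apply: limr_le; first by apply/cvg_ex; eexists; exact: cR.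
  apply: nearW => n; rewrite mulrC -ler_pdivlMr ?divr_gt0// invf_div mulrC.
  apply: (le_schrodinger_map mq m0 qB) => //; first by rewrite divr_gt0.
  by move=> y; rewrite mulrAC ler_pdivlMr// [leRHS]mulrC uPvL.
Qed.

(** Both functions being fixed, the contraction applies to the same pair any number of times: the
    oscillation of [v / u] is at most [1 + r ^+ n * t] for all [n], so [v / u] is constant. *)
Lemma schrodinger_map_fixpoint_unique u v : tame u -> tame v ->
  T u = u -> T v = v -> exists2 c : R, 0 < c & forall x, v x = c * u x.
Proof.
move=> tu tv Tu Tv; have /andP[r0 r1] := r01.
have u0 x : 0 < u x by exact: tame_gt0.
have v0 x : 0 < v x by exact: tame_gt0.
have [_ [a [A [a0 uB]]]] := tu; have [_ [b [B [b0 vB]]]] := tv.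
have aA : a <= A by have /andP[+ +] := uB point; exact: le_trans.
have bB : b <= B by have /andP[+ +] := vB point; exact: le_trans.
have A0 : 0 < A by exact: lt_le_trans aA.
have B0 : 0 < B by exact: lt_le_trans bB.
(* The ratio [v / u] lies between [b / A] and [B / a], whose quotient is [1 + t]. *)
pose t : R := B * A / (a * b) - 1.
have t0 : 0 <= t by rewrite subr_ge0 ler_pdivlMr ?mulr_gt0// mul1r [leRHS]mulrC ler_pM// ltW.
have uvn n : ratio_within (1 + r ^+ n * t) u v.
  elim: n => [|n IHn].
    exists (b / A) => [|x]; first by rewrite divr_gt0.
    have /andP[ua uA] := uB x; have /andP[vb vB'] := vB x.
    rewrite expr0 mul1r /t addrC subrK; apply/andP; split.
      by rewrite (le_trans _ vb)// mulrAC ler_pdivrMr// ler_wpM2l// ltW.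
    have -> : b / A * (B * A / (a * b)) = B / a by field; rewrite !gt_eqF.
    by rewrite (le_trans vB')// mulrAC ler_pdivlMr// ler_wpM2l// ltW.
  rewrite exprS -mulrA -Tu -Tv; apply: (ratio_within_schrodinger_map mq m0 qB) => //.
  by rewrite mulr_ge0// exprn_ge0.
have le_ratio x y : v x / u x <= v y / u y.
  have cR : ((1 + r ^+ n * t) * (v y / u y)) @[n --> \oo] --> v y / u y.
    have rt : r ^+ n * t @[n --> \oo] --> 0 * t.
      by apply: cvgM; [apply: cvg_expr; rewrite ger0_norm|exact: cvg_cst].
    have : (1 + r ^+ n * t) * (v y / u y) @[n --> \oo] --> (1 + 0 * t) * (v y / u y).
      by apply: cvgM; [apply: cvgD => //|]; exact: cvg_cst.
    by rewrite mul0r addr0 mul1r.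
  rewrite -(cvg_lim _ cR)//; apply: limr_ge; first by apply/cvg_ex; eexists; exact: cR.
  apply: nearW => n; have [k k0 kuv] := uvn n.
  have /andP[_ hx] := kuv x; have /andP[hy _] := kuv y.
  apply: (@le_trans _ _ (k * (1 + r ^+ n * t))); first by rewrite ler_pdivrMr.
  rewrite mulrC ler_wpM2l//; last by rewrite ler_pdivlMr.
  by rewrite addr_ge0// mulr_ge0// exprn_ge0.
exists (v point / u point); first by rewrite divr_gt0.
move=> x; have <- : v x / u x = v point / u point by apply/eqP; rewrite eq_le !le_ratio.
by rewrite divfK// gt_eqF.
Qed.

End schrodinger_fixpoint.

(** * Measures given by a density, and integration against them *)

Section density_measure.
Local Open Scope ereal_scope.
Context d (T : measurableType d) (R : realType).

(** The tameness proof is an argument of the term so that the measure and finite measure structures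
    can be attached to it. *)
Definition density (mu : set T -> \bar R) (f : T -> R) of tame f :=
  fun A => \int[mu]_(x in A) (f x)%:E.

Section measure.
Variables (mu : {measure set T -> \bar R}) (f : T -> R) (tf : tame f).

Let density0 : density mu tf set0 = 0.
Proof. exact: integral_set0. Qed.

Let density_ge0 A : 0 <= density mu tf A.
Proof. by apply: integral_ge0 => x _; rewrite lee_fin ltW// (tame_gt0 _ tf). Qed.

Let density_sigma_additive : semi_sigma_additive (density mu tf).
Proof.
apply: semi_sigma_additive_nng_induced => [|x].
  by apply/measurable_EFinP; case: tf.
by rewrite lee_fin ltW// (tame_gt0 _ tf).
Qed.

HB.instance Definition _ := isMeasure.Build _ _ _ (density mu tf)
  density0 density_ge0 density_sigma_additive.

End measure.

Section finite_measure.
Variables (mu : {finite_measure set T -> \bar R}) (f : T -> R) (tf : tame f).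

Let density_fin_num : fin_num_fun (density mu tf).
Proof.
move=> A mA; apply: integrable_fin_num => //.
by apply: (integrableS measurableT) => //; exact: integrable_tame.
Qed.

HB.instance Definition _ := @Measure_isFinite.Build _ T _ (density mu tf)
  density_fin_num.

End finite_measure.

Section integral.
Variables (mu nu : {measure set T -> \bar R}) (f : T -> R).
Hypotheses (mf : measurable_fun setT f) (f0 : forall x, (0 <= f x)%R).
Hypothesis nuE : forall A, measurable A -> nu A = \int[mu]_(x in A) (f x)%:E.
Variables (D : set T) (mD : measurable D).

Import HBNNSimple.

Let integral_density_nnsfun (h : {nnsfun T >-> R}) :
  \int[nu]_(x in D) (h x)%:E = \int[mu]_(x in D) ((h x)%:E * (f x)%:E).
Proof.
have mfE : measurable_fun D (EFin \o f).
  by apply/measurable_EFinP; exact: measurable_funTS.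
under [LHS]eq_integral do rewrite fimfunE -fsumEFin//.
rewrite [LHS]ge0_integral_fsum//; last 2 first.
  - by move=> r; exact/measurable_EFinP/measurableT_comp.
  - by move=> n x _; rewrite EFinM nnfun_muleindic_ge0.
under [RHS]eq_integral.
  move=> x xD; rewrite fimfunE -fsumEFin// muleC ge0_mule_fsumr; last first.
    by move=> r; rewrite EFinM nnfun_muleindic_ge0.
  over.
rewrite [RHS]ge0_integral_fsum//; last 2 first.
  - move=> r; apply: emeasurable_funM => //.
    by apply/measurable_EFinP; do 2 apply/measurableT_comp => //.
  - by move=> n x _; apply: mule_ge0; [|rewrite EFinM nnfun_muleindic_ge0//]; rewrite lee_fin.
apply: eq_fsbigr => r _.
have mr : measurable (h @^-1` [set r]) by exact: measurable_sfunP.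
rewrite integralZl_indic_nnsfun//= integral_indic// nuE; last exact: measurableI.
(* A negative [r] is not a value of [h], and both sides vanish. *)
have [r0|r0] := leP 0%R r; last first.
  rewrite preimage_nnfun0// set0I integral_set0 mule0.
  by apply/esym/integral0_eq => x _; rewrite indicE in_set0 mulr0 mule0.
rewrite setIC integral_mkcondr -ge0_integralZl//; last 2 first.
- by apply/(measurable_restrict _ mr mD)/measurable_funTS/measurable_EFinP.
- by move=> x _; apply: erestrict_ge0 => y _; rewrite lee_fin.
by apply: eq_integral => x _; rewrite epatch_indic EFinM muleCA muleC.
Qed.

(** Linearity gives the case of simple functions, and monotone convergence the rest. [nu] is any
    measure with the given values, so the result serves both for prescribed marginals and for
    constructed densities. *)
Lemma ge0_integral_density (h : T -> \bar R) : measurable_fun D h ->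
  (forall x, D x -> 0 <= h x) ->
  \int[nu]_(x in D) h x = \int[mu]_(x in D) (h x * (f x)%:E).
Proof.
move=> mh h0; pose h_ := nnsfun_approx mD mh.
have mfE : measurable_fun D (EFin \o f).
  by apply/measurable_EFinP; exact: measurable_funTS.
transitivity (limn (fun n => \int[nu]_(x in D) (h_ n x)%:E)).
  rewrite -monotone_convergence//=.
  - apply: eq_integral => x /[!inE] xD; apply/esym/cvg_lim => //=.
    exact: cvg_nnsfun_approx.
  - by move=> n; apply: measurableT_comp => //; exact: measurable_funTS.
  - by move=> n x _; rewrite lee_fin.
  - by move=> x _ a b ab; rewrite lee_fin//; exact/lefP/nd_nnsfun_approx.
transitivity (limn (fun n => \int[mu]_(x in D) ((h_ n x)%:E * (f x)%:E))).
  by congr (limn _); apply/funext => n; exact: integral_density_nnsfun.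
rewrite -monotone_convergence//=.
- apply: eq_integral => x /[!inE] xD; apply/cvg_lim => //=.
  by apply: cvgeMr => //; exact: cvg_nnsfun_approx.
- move=> n; apply: emeasurable_funM => //.
  by apply: measurableT_comp => //; exact: measurable_funTS.
- by move=> n x _; rewrite mule_ge0// lee_fin.
- move=> x _ a b ab; rewrite lee_wpmul2r// lee_fin//.
  exact/lefP/nd_nnsfun_approx.
Qed.

End integral.

(** Dividing a density out turns [mu0 = u nu0] into [nu0 = mu0 / u], and conversely. *)
Lemma integral_densityV (mu nu : {measure set T -> \bar R})
    (f : T -> R) A : tame f ->
  (forall A, measurable A -> nu A = \int[mu]_(x in A) (f x)%:E) ->
  measurable A -> \int[nu]_(x in A) (f x)^-1%:E = mu A.
Proof.
move=> tf nuE mA; rewrite (ge0_integral_density (mu := mu) (f := f))//.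
- rewrite -[RHS]mul1e -integral_cst//; apply: eq_integral => x _.
  by rewrite -EFinM mulVf// gt_eqF// tame_gt0.
- by case: tf.
- by move=> x; rewrite ltW// tame_gt0.
- by apply/measurable_EFinP/measurable_funTS; case: (tameV tf).
- by move=> x _; rewrite lee_fin ltW// (tame_gt0 _ (tameV tf)).
Qed.

End density_measure.

(** This moves the weight from the measure into the integrand, where [scaling] has it. *)
Lemma kint_density d d' (Z : measurableType d) (W : measurableType d')
    (R : realType) (k : Z * W -> R) (m M : R)
    (mu nu : {finite_measure set W -> \bar R}) (f : W -> R) :
  measurable_fun setT k -> 0 < m -> (forall z, m <= k z <= M) -> tame f ->
  (forall A, measurable A -> nu A = \int[mu]_(x in A) (f x)%:E)%E ->
  kint k nu (cst 1) = kint k mu f.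
Proof.
move=> mk m0 kB tf nuE; apply/funext => z; apply: EFin_inj.
rewrite !(EFin_kint mk m0 kB)//; last exact: tame_cst.
have mkz : measurable_fun setT (fun w => k (z, w)) by exact: measurable_ker.
rewrite (ge0_integral_density (mu := mu) (f := f))//.
- by apply: eq_integral => w _; rewrite mulr1 EFinM.
- by case: tf.
- by move=> x; rewrite ltW// tame_gt0.
- by apply/measurable_EFinP/measurable_funM.
- move=> w _; rewrite mulr1 lee_fin; have /andP[+ _] := kB (z, w).
  by apply: le_trans; exact: ltW.
Qed.

(** * From pairs of measures to fixed points and back *)

Section schrodinger_system.
Local Open Scope ereal_scope.
Context d0 d1 (X : measurableType d0) (Y : measurableType d1) (R : realType).
Variables (q : X * Y -> R) (m M : R).
Hypotheses (mq : measurable_fun setT q) (m0 : (0 < m)%R).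
Hypothesis qB : forall z, (m <= q z <= M)%R.

Let q' : Y * X -> R := q \o swap.

Let mq' : measurable_fun setT q'.
Proof. by apply: (measurableT_comp mq); exact: measurable_swap. Qed.

Let q'B z : (m <= q' z <= M)%R. Proof. exact: qB. Qed.

Let tq : tame q. Proof. by split => //; exists m, M. Qed.

Let q0 z : (0 <= q z)%R. Proof. by rewrite ltW// tame_gt0. Qed.

Section marginals.
Variables (nu0 : {finite_measure set X -> \bar R})
          (nu1 : {finite_measure set Y -> \bar R}).

Lemma integral_product_fst A : measurable A ->
  \int[nu0 \x nu1]_(z in A `*` setT) (q z)%:E =
  \int[nu0]_(x in A) (kint q nu1 (cst 1%R) x)%:E.
Proof.
move=> mA; have mAT : measurable (A `*` [set: Y]) by exact: measurableX.
rewrite integral_mkcond fubini_tonelli1.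
- rewrite [RHS]integral_mkcond; apply: eq_integral => x _.
  rewrite /fubini_F !patchE; have [xA|xA] := boolP (x \in A).
    rewrite (EFin_kint mq m0 qB); last exact: tame_cst.
    apply: eq_integral => y _; rewrite patchE mem_set ?mulr1//.
    by split => //; exact: set_mem.
  rewrite integral0_eq// => y _; rewrite patchE ifF//.
  by apply/negP => /set_mem[/mem_set]; rewrite (negbTE xA).
- by apply/(measurable_restrictT _ mAT)/measurable_funTS/measurable_EFinP.
- by move=> z; apply: erestrict_ge0 => ? _; rewrite lee_fin.
Qed.

Lemma integral_product_snd B : measurable B ->
  \int[nu0 \x nu1]_(z in setT `*` B) (q z)%:E =
  \int[nu1]_(y in B) (kint q' nu0 (cst 1%R) y)%:E.
Proof.
move=> mB; have mTB : measurable ([set: X] `*` B) by exact: measurableX.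
rewrite integral_mkcond fubini_tonelli2.
- rewrite [RHS]integral_mkcond; apply: eq_integral => y _.
  rewrite /fubini_G !patchE; have [yB|yB] := boolP (y \in B).
    rewrite (EFin_kint mq' m0 q'B); last exact: tame_cst.
    apply: eq_integral => x _; rewrite patchE mem_set ?mulr1//.
    by split => //; exact: set_mem.
  rewrite integral0_eq// => x _; rewrite patchE ifF//.
  by apply/negP => /set_mem[_ /mem_set]; rewrite (negbTE yB).
- by apply/(measurable_restrictT _ mTB)/measurable_funTS/measurable_EFinP.
- by move=> z; apply: erestrict_ge0 => ? _; rewrite lee_fin.
Qed.

End marginals.

Variables (mu0 : probability X R) (mu1 : probability Y R).

Local Notation T := (schrodinger_map q mu0 mu1).

Let mu0_gt0 : 0 < mu0 setT. Proof. by rewrite probability_setT. Qed.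

(** By Tonelli the marginals of [pi] have densities [u] and [p] with respect to [nu0] and [nu1].
    Solving for [nu0] and [nu1] and substituting into the integrals that define [p] and [u] yields
    the fixed-point equation. *)
Lemma schrodinger_pair_fixpoint (pi nu : {measure set (X * Y) -> \bar R}) :
  schrodinger_pair mu0 mu1 q pi nu ->
  exists (u : X -> R) (nu0 : {finite_measure set X -> \bar R})
    (nu1 : {finite_measure set Y -> \bar R}),
  [/\ tame u, T u = u,
    forall A, measurable A -> nu0 A = \int[mu0]_(x in A) (u x)^-1%:E,
    forall B, measurable B ->
      nu1 B = \int[mu1]_(y in B) (scaling (q \o swap) mu0 u y)^-1%:E &
    forall E, measurable E -> nu E = (nu0 \x nu1) E].
Proof.
move=> [piT [nu0 [nu1 nuE]] pi0 pi1 dpi].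
have piE E : measurable E -> pi E = \int[nu0 \x nu1]_(z in E) (q z)%:E.
  by move=> mE; rewrite dpi//; apply: eq_measure_integral => A mA _; exact: nuE.
(* If either factor had mass zero, [pi] would have mass at most [M * 0] instead of 1. Positive
   masses bound [u] and [p] away from zero. *)
have /andP[nu0T nu1T] : (0 < nu0 setT) && (0 < nu1 setT).
  rewrite !lt0e !measure_ge0 !andbT -negb_or -mule_eq0 -product_measure1E// setXTT.
  apply/eqP => nu00; have : (1 <= 0 :> \bar R).
    rewrite -piT piE// -[leRHS](mule0 M%:E) -nu00 -integral_cst//.
    apply: ge0_le_integral => //.
    - by move=> z _; rewrite lee_fin.
    - exact/measurable_EFinP.
    - by move=> z _; rewrite lee_fin; have /andP[] := qB z.
  by rewrite lee_fin ler10.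
pose u := kint q nu1 (cst 1%R); pose p := kint q' nu0 (cst 1%R).
have tu : tame u by apply: (tame_kint mq m0 qB) => //; exact: tame_cst.
have tp : tame p by apply: (tame_kint mq' m0 q'B) => //; exact: tame_cst.
have mu0E A : measurable A -> mu0 A = \int[nu0]_(x in A) (u x)%:E.
  by move=> mA; rewrite -pi0// piE ?integral_product_fst//; exact: measurableX.
have mu1E B : measurable B -> mu1 B = \int[nu1]_(y in B) (p y)%:E.
  by move=> mB; rewrite -pi1// piE ?integral_product_snd//; exact: measurableX.
have nu0E A : measurable A -> nu0 A = \int[mu0]_(x in A) (u x)^-1%:E.
  by move=> mA; rewrite (integral_densityV tu mu0E).
have nu1E B : measurable B -> nu1 B = \int[mu1]_(y in B) (p y)^-1%:E.
  by move=> mB; rewrite (integral_densityV tp mu1E).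
have pE : p = scaling q' mu0 u by exact: (kint_density mq' m0 q'B (tameV tu)).
exists u, nu0, nu1; split => //; last by rewrite -pE.
by rewrite /schrodinger_map -pE; apply/esym/(kint_density mq m0 qB (tameV tp)).
Qed.

Lemma schrodinger_pair_unique (pi nu pi' nu' : {measure set (X * Y) -> \bar R}) :
  schrodinger_pair mu0 mu1 q pi nu -> schrodinger_pair mu0 mu1 q pi' nu' ->
  forall E, measurable E -> pi' E = pi E /\ nu' E = nu E.
Proof.
move=> s s'; have [_ _ _ _ dpi] := s; have [_ _ _ _ dpi'] := s'.
have [u [nu0 [nu1 [tu Tu nu0E nu1E nuE]]]] := schrodinger_pair_fixpoint s.
have [v [nu0' [nu1' [tv Tv nu0E' nu1E' nuE']]]] := schrodinger_pair_fixpoint s'.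
have [c c0 vcu] := schrodinger_map_fixpoint_unique mq m0 qB tu tv Tu Tv.
have {}vcu : v = (fun x => c * u x)%R by exact/funext.
have tp : tame (scaling q' mu0 u).
  exact: (tame_scaling mq' m0 q'B mu0_gt0).
have cV0 : (0 <= c^-1)%R by rewrite invr_ge0 ltW.
have nu0c A : measurable A -> nu0' A = c^-1%:E * nu0 A.
  move=> mA; rewrite nu0E' ?nu0E//.
  rewrite -ge0_integralZl ?lee_fin//.
  - by apply: eq_integral => x _; rewrite vcu invfM.
  - by apply/measurable_EFinP/measurable_funTS; case: (tameV tu).
  - by move=> x _; rewrite lee_fin ltW// (tame_gt0 _ (tameV tu)).
have nu1c B : measurable B -> nu1' B = c%:E * nu1 B.
  move=> mB; rewrite nu1E' ?nu1E// vcu (scalingZ mq' m0 q'B)//.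
  rewrite -ge0_integralZl ?lee_fin ?ltW//.
  - by apply: eq_integral => x _; rewrite invfM invrK.
  - by apply/measurable_EFinP/measurable_funTS; case: (tameV tp).
  - by move=> x _; rewrite lee_fin ltW// (tame_gt0 _ (tameV tp)).
(* The factors [c^-1] and [c] cancel on rectangles, and rectangles determine the product of finite
   measures. *)
have nunu' E : measurable E -> nu' E = nu E.
  move=> mE; rewrite nuE// nuE'//; apply/esym.
  apply: (product_measure_unique (m1 := nu0) (m2 := nu1)) => // A B mA mB.
  transitivity (nu0' A * nu1' B); first exact: product_measure1E.
  rewrite nu0c// nu1c// muleACA -EFinM.
  by rewrite mulVf ?gt_eqF// mul1e.
move=> E mE; split; last exact: nunu'.
by rewrite dpi// dpi'//; apply: eq_measure_integral => A mA _; exact: nunu'.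
Qed.

(** Take [nu0 = mu0 / u], [nu1 = mu1 / p] and [pi = q nu]. The first marginal condition is then
    [T u = u], the second is the definition of [p], and the total mass of [pi] is read off a
    marginal. *)
Lemma schrodinger_pair_exists : exists pi nu : {measure set (X * Y) -> \bar R},
  schrodinger_pair mu0 mu1 q pi nu.
Proof.
have [u tu Tu] := schrodinger_map_fixpoint mq m0 qB mu0 mu1.
have tp : tame (scaling q' mu0 u).
  exact: (tame_scaling mq' m0 q'B mu0_gt0). all: try done.
pose nu0 : {finite_measure set X -> \bar R} := density mu0 (tameV tu).
pose nu1 : {finite_measure set Y -> \bar R} := density mu1 (tameV tp).
have marg0 A : measurable A ->
    \int[nu0 \x nu1]_(z in A `*` setT) (q z)%:E = mu0 A.
  move=> mA; rewrite integral_product_fst//.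
  rewrite (kint_density mq m0 qB (tameV tp) (mu := mu1))// -[kint _ _ _]/(T u) Tu.
  rewrite -(integral_densityV (tameV tu) (mu := mu0) (nu := nu0))//.
  by apply: eq_integral => x _; rewrite invrK.
have marg1 B : measurable B ->
    \int[nu0 \x nu1]_(z in setT `*` B) (q z)%:E = mu1 B.
  move=> mB; rewrite integral_product_snd//.
  rewrite (kint_density mq' m0 q'B (tameV tu) (mu := mu0))// -/(scaling q' mu0 u).
  rewrite -(integral_densityV (tameV tp) (mu := mu1) (nu := nu1))//.
  by apply: eq_integral => y _; rewrite invrK.
exists (density (nu0 \x nu1) tq), (nu0 \x nu1); split => //.
- rewrite -setXTT; transitivity (mu0 setT); first exact: marg0.
  exact: probability_setT.
- by exists nu0, nu1.
Qed.

End schrodinger_system.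

(** * Continuous functions on the compact product: measurability and bounds *)

Lemma compact_set_type (X : topologicalType) (S : set X) :
  compact S -> compact [set: set_type S].
Proof.
move=> cS; have [S0|/set0P S_neq0] := eqVneq S set0.
  suff -> : [set: set_type S] = set0 by exact: compact0.
  by apply/seteqP; split=> // -[x xS] _; have := set_mem xS; rewrite {1}S0.
have [s Ss] := S_neq0.
(* The subtype is the image of [S] under this map, which is the identity on [S] and hence continuous
   there; the value [s] outside [S] is arbitrary. *)
pose f (x : X) : set_type S :=
  if pselect (x \in S) is left h then exist _ x h else exist _ s (mem_set Ss).
have fK (x : set_type S) : f (set_val x) = x.
  rewrite /f; case: pselect => [h|]; first exact/val_inj.
  by case; apply/mem_set; exact: set_valP.
have -> : [set: set_type S] = f @` S.
  by apply/seteqP; split=> // x _; exists (set_val x) => //; exact: set_valP.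
apply: continuous_compact => //; apply/subspace_sigL_continuousP.
rewrite (_ : sigL S f = id); last by apply/funext => x; exact: fK.
by move=> x; exact: cvg_id.
Qed.

(** A compact pseudometric space is second countable; the point [s] only supplies the pointed
    structure. *)
Lemma second_countable_set_type (R : realType) (X : pseudoMetricType R) (S : set X) :
  S !=set0 -> compact S -> @second_countable (set_type S).
Proof.
move=> S_neq0 /compact_set_type cS.
have [s Ss] := cid S_neq0.
pose pS := isPointed.Build (set_type S) (exist _ s (mem_set Ss)).
pose T : pseudoPMetricType R := HB.pack (set_type S) pS.
exact: (@compact_second_countable R T).
Qed.

Lemma countable_bigcup_measurable d (T : measurableType d) (U : Type)
    (D : set U) (F : U -> set T) :
  countable D -> (forall i, D i -> measurable (F i)) ->
  measurable (\bigcup_(i in D) F i).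
Proof.
move=> /pfcard_geP[->|[f]] mF; first by rewrite bigcup_set0.
rewrite -(image_eq f) bigcup_image; apply: bigcupT_measurable => k.
by apply: mF; exact: funS.
Qed.

Section borel_sub_product.
Context (R : realType) (n : nat) (S0 S1 : set 'rV[R]_n).
Hypotheses (S0_neq0 : S0 !=set0) (S1_neq0 : S1 !=set0).
Hypotheses (S0_compact : compact S0) (S1_compact : compact S1).

(** An open set is a union of open rectangles; countable bases of both factors make the union
    countable, so it belongs to the product of the Borel sigma-fields. *)
Lemma open_measurable_borel_sub_prod (U : set (S0 * S1)) : open U ->
  measurable (U : set (borel_sub S0_neq0 * borel_sub S1_neq0)).
Proof.
move=> oU.
have [B0 cB0 [oB0 nB0]] := second_countable_set_type S0_neq0 S0_compact.
have [B1 cB1 [oB1 nB1]] := second_countable_set_type S1_neq0 S1_compact.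
pose W := [set V : set S0 * set S1 | [/\ B0 V.1, B1 V.2 & V.1 `*` V.2 `<=` U]].
have -> : U = \bigcup_(V in W) (V.1 `*` V.2).
  apply/seteqP; split=> [[x y] Uxy|z [V [_ _ VU] /VU//]].
  have [[P Q] /= [nP nQ] PQ] : nbhs (x, y) U by exact: open_nbhs_nbhs.
  have [V0 [BV0 V0x] V0P] := nB0 x _ nP; have [V1 [BV1 V1y] V1Q] := nB1 y _ nQ.
  exists (V0, V1) => //=; split => //= -[a b] /= [V0a V1b].
  by apply: PQ; split; [exact: V0P|exact: V1Q].
apply: countable_bigcup_measurable => [|V [BV0 BV1 _]].
  apply: (@sub_countable _ _ _ (B0 `*` B1)); last exact: countableX.
  by apply: subset_card_le => V [].
by apply: measurableX; apply: sub_sigma_algebra; [exact: oB0|exact: oB1].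
Qed.

Variable q : S0 * S1 -> R.
Hypothesis q_continuous : continuous q.

Lemma continuous_measurable_borel_sub_prod :
  measurable_fun [set: borel_sub S0_neq0 * borel_sub S1_neq0] q.
Proof.
move=> mT; apply: (measurability _ (RGenOpens.measurableE R)) => //.
move=> _ [_ [a [b ->] <-]]; rewrite setTI; apply: open_measurable_borel_sub_prod.
by apply: open_comp => //; exact: interval_open.
Qed.

(** The extrema are attained by compactness, so the minimum is itself a value of [q] and thus
    positive. *)
Lemma continuous_gt0_bounded : (forall z, 0 < q z) ->
  exists m M, 0 < m /\ forall z, m <= q z <= M.
Proof.
move=> q_gt0.
have cT : compact [set: S0 * S1].
  by rewrite -setXTT; apply: compact_setX; exact: compact_set_type.
have [s0 Ss0] := S0_neq0; have [s1 Ss1] := S1_neq0.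
have T_neq0 : [set: S0 * S1] !=set0.
  by exists (exist _ s0 (mem_set Ss0), exist _ s1 (mem_set Ss1)).
have wq : {within [set: S0 * S1], continuous q} by exact: continuous_subspaceT.
have [c _ cq] := compact_EVT_min T_neq0 cT wq.
have [C _ Cq] := compact_EVT_max T_neq0 cT wq.
by exists (q c), (q C); split=> // z; rewrite cq ?Cq ?in_setT.
Qed.

End borel_sub_product.

Theorem proposition2 (R : realType) (n : nat) (S0 S1 : set 'rV[R]_n)
  (S0_neq0 : S0 !=set0) (S1_neq0 : S1 !=set0)
  (S0_compact : compact S0) (S1_compact : compact S1)
  (mu0 : probability (borel_sub S0_neq0) R)
  (mu1 : probability (borel_sub S1_neq0) R)
  (mu0_ac : abs_continuous mu0) (mu1_ac : abs_continuous mu1)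
  (q : S0 * S1 -> R) (q_continuous : continuous q)
  (q_gt0 : forall z, 0 < q z) :
  exists pi nu : {measure set (borel_sub S0_neq0 * borel_sub S1_neq0) -> \bar R},
    schrodinger_pair mu0 mu1 q pi nu /\
    forall pi' nu' : {measure set (borel_sub S0_neq0 * borel_sub S1_neq0) -> \bar R},
      schrodinger_pair mu0 mu1 q pi' nu' ->
      forall E, measurable E -> pi' E = pi E /\ nu' E = nu E.
Proof.
have mq : measurable_fun [set: borel_sub S0_neq0 * borel_sub S1_neq0] q.
  exact: continuous_measurable_borel_sub_prod.
have [m [M [m0 qB]]] :=
  continuous_gt0_bounded S0_neq0 S1_neq0 S0_compact S1_compact q_continuous q_gt0.
have [pi [nu s]] := schrodinger_pair_exists mq m0 qB mu0 mu1.
exists pi, nu; split => // pi' nu' s'.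
exact: schrodinger_pair_unique mq m0 qB _ _ _ _ _ _ s s'.
Qed.
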